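(* Let $\alpha,\beta>-1$. For every integer $n\ge0$, the weighted normalized Jacobi polynomial $\hat P_n^{(\alpha,\beta)}$ is an eigenfunction of the following linear differential equation on $(-1,1)$: $$ -(1-x^2)\frac{d}{dx}\left[(1-x^2)\frac{d}{dx}\hat{P}_n^{(\alpha,\beta)}(x)\right] + \left(\left(\tfrac{\alpha}{2}\right)^2(1+x)^2+\left(\tfrac{\beta}{2}\right)^2(1-x)^2-\tfrac{\alpha\beta+\alpha+\beta}{2}(1-x^2)\right)\hat{P}_n^{(\alpha,\beta)}(x) = n(n+\alpha+\beta+1)(1-x^2)\hat{P}_n^{(\alpha,\beta)}(x). $$
   Context: $P_n^{(\alpha,\beta)}$ denotes the Jacobi polynomial, orthogonal with respect to $(1-x)^\alpha(1+x)^\beta\,dx$ on $[-1,1]$ with standard normalization; $$\tilde P_n^{(\alpha,\beta)}(x)=\sqrt{\frac{(2n+\alpha+\beta+1)\Gamma(n+\alpha+\beta+1)\,n!}{2^{\alpha+\beta+1}\Gamma(n+\alpha+1)\Gamma(n+\beta+1)}}\,P_n^{(\alpha,\beta)}(x)$$ is the orthonormal Jacobi polynomial (for $n=0$, $\alpha+\beta=-1$, the product $(\alpha+\beta+1)\Gamma(\alpha+\beta+1)$ is understood as $\Gamma(\alpha+\beta+2)$); and the weighted normalized Jacobi polynomial is $$\hat{P}_n^{(\alpha,\beta)}(x) = (1-x)^{\alpha/2}(1+x)^{\beta/2}\tilde{P}_n^{(\alpha,\beta)}(x).$$ *)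

(* Defs.v *)
From HB Require Import structures.
From mathcomp Require Import all_boot all_order all_algebra.
From mathcomp Require Import all_classical all_reals all_analysis.

Set Implicit Arguments.
Unset Strict Implicit.
Unset Printing Implicit Defensive.

Import Order.TTheory GRing.Theory Num.Theory.
Import numFieldNormedType.Exports.

Local Open Scope classical_set_scope.
Local Open Scope ring_scope.

Definition gamma_integral (R : realType) (s : R) : R :=
  Rintegral (@lebesgue_measure R) `]0, +oo[%classic
    (fun t => t `^ (s - 1) * expR (- t)).

(* Euler's integral for s > 0, extended to non-integral s < 0 by the functional
   equation Gamma (s + 1) = s Gamma s, applied m times where m is the least
   natural number with 0 < s + m. At the poles s = 0, -1, -2, ... the value is
   0, by the convention x / 0 = 0. *)
Definition gamma (R : realType) (s : R) : R :=
  let m := if 0 < s then 0%N else (Num.truncn (- s)).+1 in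
  gamma_integral (s + m%:R) / \prod_(k < m) (s + k%:R).

(* P_n is of degree n, the P_n are orthogonal for the weight
   (1 - x)^a (1 + x)^b on [-1, 1], and P_n(1) is the binomial coefficient
   (n + a choose n) = (a + 1) ... (a + n) / n!. The integral takes values in
   \bar R, so that equality with 0 excludes an undefined integral. *)
Definition jacobi_polynomials (R : realType) (a b : R) (P : nat -> {poly R}) :
    Prop :=
  [/\ forall n, size (P n) = n.+1,
      forall m n, m <> n ->
        (\int[@lebesgue_measure R]_(x in `[(-1)%R, 1%R])
          ((1 - x) `^ a * (1 + x) `^ b * (P m).[x] * (P n).[x])%R%:E = 0)%E &
      forall n, (P n).[1] = \prod_(1 <= k < n.+1) ((a + k%:R) / k%:R)].

Definition jacobi_norm_const (R : realType) (a b : R) (n : nat) : R :=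
  let c := if (n == 0%N) && (a + b == -1) then gamma (a + b + 2)
           else (2 * n%:R + a + b + 1) * gamma (n%:R + a + b + 1) in
  Num.sqrt (c * n`!%:R /
    (2 `^ (a + b + 1) * gamma (n%:R + a + 1) * gamma (n%:R + b + 1))).

Definition jacobi_orthonormal (R : realType) (a b : R) (P : nat -> {poly R})
    (n : nat) (x : R) : R :=
  jacobi_norm_const a b n * (P n).[x].

Definition jacobi_weighted (R : realType) (a b : R) (P : nat -> {poly R})
    (n : nat) (x : R) : R :=
  (1 - x) `^ (a / 2) * (1 + x) `^ (b / 2) * jacobi_orthonormal a b P n x.

(* Main.v *)
Require Import Defs.
From HB Require Import structures.
From mathcomp Require Import all_boot all_order all_algebra.
From mathcomp Require Import all_classical all_reals all_analysis.
From mathcomp Require Import measurable_realfun ring lra.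
Import Order.TTheory GRing.Theory Num.Theory.
Import numFieldNormedType.Exports.
Local Open Scope classical_set_scope.
Local Open Scope ring_scope.

Set Implicit Arguments.
Unset Strict Implicit.
Unset Printing Implicit Defensive.

(** Let w = (1 - x)^a (1 + x)^b and L p = (1 - x^2) p'' + (b - a - (a + b + 2) x) p'.
    Since w (L p q - p L q) is the derivative of
    (1 - x)^(a + 1) (1 + x)^(b + 1) (p' q - p q'), which vanishes at both ends,
    L is symmetric for the inner product with weight w. Put
    r = L P_n + n (n + a + b + 1) P_n. The coefficient of x^n in r cancels, so r
    has degree < n, and <r, r> = <P_n, L r + n (n + a + b + 1) r> = 0 because L
    does not raise degrees. Hence r = 0, which is Jacobi's equation, and
    conjugating by w^(1/2) gives the equation for the weighted polynomial. It is
    nonzero because the normalizing constant, a quotient of Gamma values, is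
    positive. *)

(** * Calculus up to the endpoints of an interval *)

Lemma derivative_const (R : realType) (H : R -> R) (c d : R) : c < d ->
  {within `[c, d], continuous H} ->
  (forall x, x \in `]c, d[ -> is_derive x 1 H 0) -> H d = H c.
Proof.
move=> cd Hc H'.
have [_ _ /eqP] := @MVT R H (fun=> 0) c d cd H' Hc.
by rewrite mul0r subr_eq0 => /eqP.
Qed.

(** [f] may blow up at the ends. The indefinite integral of [f] and [F] are both continuous on
    [c, d] and have derivative [f] inside, so their difference is constant. *)
Lemma improper_FTC2 (R : realType) (F f : R -> R) (c d : R) : c < d ->
  {within `[c, d], continuous F} ->
  (forall x, x \in `]c, d[ -> is_derive x 1 F (f x)) ->
  {in `]c, d[, continuous f} ->
  (@lebesgue_measure R).-integrable `[c, d] (EFin \o f) ->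
  \int[@lebesgue_measure R]_(x in `[c, d]) f x = F d - F c.
Proof.
move=> cd cF dF cf fint.
pose G x := \int[@lebesgue_measure R]_(t in `[c, x]) f t.
have cG : {within `[c, d], continuous G}.
  exact: (parameterized_integral_continuous (ltW cd) fint).
have H' : forall x, x \in `]c, d[ -> is_derive x 1 (G \- F) 0.
  move=> x xcd; have /andP[cx xd] : c < x < d by rewrite in_itv in xcd.
  have [dG G'] := continuous_FTC1_closed xd fint cx (cf x xcd).
  have gx : is_derive x 1 G (f x) by rewrite -G' derive1E; exact/derivableP.
  have := dF x xcd => fx.
  by rewrite -(subrr (f x)); exact: is_deriveB.
have cH : {within `[c, d], continuous (G \- F)}.
  by move=> x; apply: continuousB; [exact: cG|exact: cF].
have Gc : G c = 0 by rewrite /G set_itv1 Rintegral_set1.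
have := derivative_const cd cH H'.
rewrite /= Gc -/(G d) => H; lra.
Qed.

(** The integrals over closed subintervals exhausting the open one are increments of the
    nondecreasing [F], hence at most F(d) - F(c). Monotone convergence carries this bound to the
    whole interval. *)
Lemma ge0_derivative_integrable (R : realType) (F f : R -> R) (c d : R) : c < d ->
  {within `[c, d], continuous F} ->
  (forall x, x \in `]c, d[ -> is_derive x 1 F (f x)) ->
  {in `]c, d[, continuous f} ->
  {in `]c, d[, forall x, 0 <= f x} ->
  (@lebesgue_measure R).-integrable `[c, d] (EFin \o f).
Proof.
move=> cd cF dF cf f0.
have moo : measurable_fun `]c, d[ f.
  apply: open_continuous_measurable_fun; first exact: interval_open.
  by move=> x /set_mem; exact: cf.
have mcc : measurable_fun `[c, d] (EFin \o f).
  by apply/measurable_EFinP; exact: measurable_fun_itv_cc moo.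
apply/integrableP; split => //.
rewrite integral_itv_bndoo; last first.
  by apply: measurableT_comp => //; exact/measurable_EFinP.
have -> : (\int[lebesgue_measure]_(x in `]c, d[) `|(EFin \o f) x| =
          \int[lebesgue_measure]_(x in `]c, d[) (f x)%:E)%E.
  by apply: eq_integral => x /set_mem xcd; rewrite /= ger0_norm // f0.
(* The denominator [n.+3] keeps the margin below half the length, so every [S n] is nondegenerate,
   already for n = 0. *)
pose e (n : nat) : R := (d - c) / n.+3%:R.
have e0 n : 0 < e n by rewrite divr_gt0 ?subr_gt0.
have ed n : c + e n < d - e n.
  have : (d - c) / n.+3%:R < (d - c) / 2 by rewrite ltr_pM2l ?subr_gt0// ltf_pV2 ?posrE ?ltr_nat.
  rewrite -/(e n); lra.
have emono n m : (n <= m)%N -> e m <= e n.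
  by move=> nm; rewrite ler_pM2l ?subr_gt0// lef_pV2 ?posrE ?ler_nat.
pose S n : set R := `[c + e n, d - e n]%classic.
have Sin n x : S n x -> x \in `]c, d[.
  by rewrite /S /= !in_itv /= => /andP[]; have := e0 n; lra.
have SE : `]c, d[%classic = \bigcup_n S n.
  apply/seteqP; split => [x|x [n _ /Sin//]].
  rewrite /= in_itv/= => /andP[cx xd].
  (* The distance from [x] to the nearer endpoint: [x] lies in [S k] once [e k] is below it. *)
  pose m := Num.min (x - c) (d - x).
  have m0 : 0 < m by rewrite lt_min !subr_gt0 cx xd.
  have /archi_boundP : 0 <= (d - c) / m by rewrite divr_ge0 ?subr_ge0 ?ltW.
  set k := Num.bound _ => Hk.
  have ek : e k < m.
    rewrite ltr_pdivrMr// mulrC -ltr_pdivrMr//; apply: (lt_trans Hk).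
    by rewrite ltr_nat; do 2 apply: leqW.
  exists k => //; rewrite /S /= in_itv/=.
  by move: ek; rewrite lt_min; lra.
have nS : nondecreasing_seq S.
  move=> n m nm; apply/subsetPset => x; rewrite /S /= !in_itv/=.
  by have := emono _ _ nm; lra.
have mS n : measurable_fun (S n) (EFin \o f).
  apply/measurable_EFinP; apply: measurable_funS moo => //.
  by move=> x /Sin.
have cvgS : (\int[@lebesgue_measure R]_(x in S n) (f x)%:E @[n --> \oo] -->
    \int[@lebesgue_measure R]_(x in `]c, d[) (f x)%:E)%E.
  rewrite SE; apply: ge0_nondecreasing_set_cvg_integral => //.
  - by move=> i; exact: measurable_itv.
  - by move=> i x /Sin xcd; rewrite lee_fin f0.
have Sle n : (\int[lebesgue_measure]_(x in S n) (f x)%:E <= (F d - F c)%:E)%E.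
  have Scn : {in `[c + e n, d - e n], forall x, x \in `]c, d[} by move=> x /Sin.
  have cFin : {in `]c, d[, continuous F}.
    move=> x xcd; apply: differentiable_continuous; apply/derivable1_diffP.
    exact: (@ex_derive _ _ _ _ _ _ _ (dF x xcd)).
  have cS : F c <= F (c + e n) /\ F (d - e n) <= F d.
    have mono : {in `[c, d] &, {homo F : x y / x <= y}}.
      apply: (ger0_derive1_le _ _ (sa := true) (sb := false)) => //.
      - by move=> x xcd; exact: (@ex_derive _ _ _ _ _ _ _ (dF x xcd)).
      - move=> x xcd; rewrite derive1E (@derive_val _ _ _ _ _ _ _ (dF x xcd)).
        exact: f0.
    have := e0 n; have := ed n => ? ?.
    by split; apply: mono; rewrite ?in_itv/=; lra.
  rewrite (@continuous_FTC2 _ f F) //.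
  - by rewrite -EFinB lee_fin lerB //; tauto.
  - apply: continuous_in_subspaceT => x /set_mem/= /Scn; exact: cf.
  - split.
    + move=> x xS; apply: (@ex_derive _ _ _ _ _ _ _ (dF x _)).
      by apply: Scn; exact: subset_itv_oo_cc xS.
    + apply: cvg_at_right_filter; apply: cFin; apply: Scn.
      by rewrite in_itv/= lexx ltW// ed.
    + apply: cvg_at_left_filter; apply: cFin; apply: Scn.
      by rewrite in_itv/= lexx ltW// ed.
  - move=> x xS; rewrite derive1E; apply: (@derive_val _ _ _ _ _ _ _ (dF x _)).
    by apply: Scn; exact: subset_itv_oo_cc xS.
have : (\int[lebesgue_measure]_(x in `]c, d[) (f x)%:E <= (F d - F c)%:E)%E.
  by apply: cvge_le cvgS; apply: nearW => n; exact: Sle.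
by move=> /le_lt_trans; apply; rewrite ltry.
Qed.

(* [powR] takes the value 1 on negative bases, so [t `^ s] itself is not
   continuous at 0. *)
Lemma continuous_powR_max0 (R : realType) (s : R) : 0 <= s ->
  continuous (fun t : R => Num.max t 0 `^ s).
Proof.
rewrite le_eqVlt => /predU1P[<-|s0].
  rewrite (_ : (fun _ => _) = cst 1); first exact: cst_continuous.
  by apply/funext => t; rewrite powRr0.
move=> t; have [t0|t0|->] := ltgtP t 0.
- apply: differentiable_continuous; apply/derivable1_diffP.
  apply: (@near_eq_derivable _ _ _ (cst 0)); last exact: derivable_cst.
  near=> z; rewrite max_r ?powR0 ?gt_eqF// ltW//; near: z; exact: lt_nbhsl.
- apply: differentiable_continuous; apply/derivable1_diffP.
  apply: (@near_eq_derivable _ _ _ (fun t => t `^ s)).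
    by near=> z; rewrite max_l// ltW//; near: z; exact: lt_nbhsr.
  by apply: derivable_powR; rewrite in_itv/= t0.
- apply/left_right_continuousP; rewrite maxxx powR0 ?gt_eqF//; split.
    apply: cvg_near_cst; near=> z.
    by rewrite max_r ?powR0 ?gt_eqF//; near: z; exact: nbhs_left_le.
  apply: cvg_trans (powR_cvg0 s0); apply: near_eq_cvg; near=> z.
  by rewrite max_l//; near: z; exact: nbhs_right_ge.
Unshelve. all: by end_near. Qed.

Lemma within_continuousM (R : realType) (A : set R) (f g : R -> R) :
  {within A, continuous f} -> {within A, continuous g} ->
  {within A, continuous (fun x => f x * g x)}.
Proof. by move=> cf cg x; exact: (continuousM (cf x) (cg x)). Qed.

(** * The Jacobi weight: derivative, continuity, integrability *)

Definition jacobi_weight (R : realType) (a b x : R) : R :=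
  (1 - x) `^ a * (1 + x) `^ b.

Section JacobiWeight.
Variable R : realType.
Implicit Types a b x : R.
Local Notation mu := (@lebesgue_measure R).

Lemma jacobi_weight_gt0 a b x : -1 < x < 1 -> 0 < jacobi_weight a b x.
Proof. by move=> ?; rewrite mulr_gt0 ?powR_gt0//; lra. Qed.

Lemma jacobi_weightD a b a' b' x : -1 < x < 1 ->
  jacobi_weight (a + a') (b + b') x = jacobi_weight a b x * jacobi_weight a' b' x.
Proof.
move=> x1; have x0 : (1 - x != 0) /\ (1 + x != 0) by split; apply: lt0r_neq0; lra.
rewrite /jacobi_weight !powRD ?x0.1 ?x0.2 ?implybT//; ring.
Qed.

Lemma jacobi_weight11 x : -1 < x < 1 -> jacobi_weight 1 1 x = 1 - x ^+ 2.
Proof. by move=> x1; rewrite /jacobi_weight !powRr1; [ring|lra|lra]. Qed.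

(** Lowering both exponents by one leaves a polynomial cofactor, so that derivatives of weight times
    polynomial keep this shape. *)
Lemma is_derive_jacobi_weight a b x : -1 < x < 1 ->
  is_derive x 1 (jacobi_weight a b)
    (jacobi_weight (a - 1) (b - 1) x * (b * (1 - x) - a * (1 + x))).
Proof.
move=> x1.
have xl : 0 < 1 - x by lra.
have xr : 0 < 1 + x by lra.
have dl := @is_derive1_powR R a _ xl.
have dr := @is_derive1_powR R b _ xr.
have dlx : is_derive x 1 (fun x => 1 - x) (-1).
  by rewrite -[-1]add0r; apply: is_deriveB.
have drx : is_derive x 1 (fun x => 1 + x) 1.
  by rewrite -[X in is_derive _ _ _ X]add0r; apply: is_deriveD.
have dcl := @is_derive1_comp R (fun t => t `^ a) (fun x => 1 - x) _ _ _ dl dlx.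
have dcr := @is_derive1_comp R (fun t => t `^ b) (fun x => 1 + x) _ _ _ dr drx.
apply: (@eq_ind _ _ (is_derive x 1 (jacobi_weight a b)) (is_deriveM dcl dcr)).
rewrite /GRing.scale /=.
have powRS (c y : R) : 0 < y -> y `^ c = y * y `^ (c - 1).
  move=> y0; rewrite -[in LHS](subrKC 1 c) (@powRD _ y 1 (c - 1)) ?(gt_eqF y0) ?implybT//.
  by rewrite powRr1// ltW.
rewrite /jacobi_weight (powRS a _ xl) (powRS b _ xr).
ring.
Qed.

Lemma continuous_jacobi_weight a b : 0 <= a -> 0 <= b ->
  {within `[-1, 1], continuous (jacobi_weight a b)}.
Proof.
move=> a0 b0.
(* Truncation makes this continuous on the whole line and does not change the weight on [-1, 1]. *)
pose h x := Num.max (1 - x) 0 `^ a * Num.max (1 + x) 0 `^ b.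
apply: (@subspace_eq_continuous _ _ _ h).
  move=> x /set_mem; rewrite /= in_itv/= => x1.
  by rewrite /from_subspace /h /jacobi_weight !max_l//; lra.
apply: continuous_subspaceT => x.
rewrite /h.
apply: (@continuousM _ _ (fun x => Num.max (1 - x) 0 `^ a) (fun x => Num.max (1 + x) 0 `^ b)).
  apply: (@continuous_comp _ _ _ (fun x => 1 - x) (fun t => Num.max t 0 `^ a)).
    by apply: continuousB => //; exact: cst_continuous.
  exact: continuous_powR_max0.
apply: (@continuous_comp _ _ _ (fun x => 1 + x) (fun t => Num.max t 0 `^ b)).
  by apply: continuousD => //; exact: cst_continuous.
exact: continuous_powR_max0.
Qed.

Lemma continuous_in_jacobi_weight a b : {in `]-1, 1[, continuous (jacobi_weight a b)}.
Proof.
move=> x; rewrite in_itv/= => x1.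
apply: differentiable_continuous; apply/derivable1_diffP.
by have [] := is_derive_jacobi_weight a b x1.
Qed.

Lemma measurable_jacobi_weight a b : measurable_fun [set: R] (jacobi_weight a b).
Proof.
apply: measurable_funM.
- apply: (measurableT_comp (measurable_powR a)); exact: measurable_funB.
- apply: (measurableT_comp (measurable_powR b)); exact: measurable_funD.
Qed.

(** A multiple of (1 - x)^(a + 1) is a primitive, continuous up to x = 1 because a + 1 > 0, even
    when the integrand is unbounded there. *)
Lemma integrable_jacobi_weightl a : -1 < a ->
  mu.-integrable `[-1, 1] (EFin \o jacobi_weight a 0).
Proof.
move=> a1; have a10 : 0 <= a + 1 by lra.
apply: (@ge0_derivative_integrable R (fun x => (- (a + 1)^-1) * jacobi_weight (a + 1) 0 x)).
- lra.
- apply: within_continuousM; last exact: continuous_jacobi_weight.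
  exact: cst_continuous.
- move=> x; rewrite in_itv/= => x1.
  have dw := is_deriveZ (- (a + 1)^-1) (is_derive_jacobi_weight (a + 1) 0 x1).
  apply: (@eq_ind _ _ (is_derive x 1 _) dw); rewrite /GRing.scale/= addrK sub0r.
  (* The derivative formula yields the exponents [a] and -1; the inverse of 1 + x cancels against
     the cofactor -(a + 1)(1 + x). *)
  rewrite /jacobi_weight powRr0 powR_inv1; last lra.
  by field; apply/andP; split; apply: lt0r_neq0; lra.
- exact: continuous_in_jacobi_weight.
- by move=> x; rewrite in_itv/= => x1; apply/ltW/jacobi_weight_gt0.
Qed.

Lemma integrable_jacobi_weightr b : -1 < b ->
  mu.-integrable `[-1, 1] (EFin \o jacobi_weight 0 b).
Proof.
move=> b1; have b10 : 0 <= b + 1 by lra.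
apply: (@ge0_derivative_integrable R (fun x => (b + 1)^-1 * jacobi_weight 0 (b + 1) x)).
- lra.
- apply: within_continuousM; last exact: continuous_jacobi_weight.
  exact: cst_continuous.
- move=> x; rewrite in_itv/= => x1.
  have dw := is_deriveZ (b + 1)^-1 (is_derive_jacobi_weight 0 (b + 1) x1).
  apply: (@eq_ind _ _ (is_derive x 1 _) dw); rewrite /GRing.scale/= addrK sub0r.
  rewrite /jacobi_weight powRr0 powR_inv1; last lra.
  by field; apply/andP; split; apply: lt0r_neq0; lra.
- exact: continuous_in_jacobi_weight.
- by move=> x; rewrite in_itv/= => x1; apply/ltW/jacobi_weight_gt0.
Qed.

(** Only one factor can be singular at a time: 1 + x lies in [1, 2] for x >= 0, and 1 - x does for x
    < 0. The regular factor is absorbed in the constant [C], where absolute values cover both signs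
    of the exponents. *)
Lemma integrable_jacobi_weight a b : -1 < a -> -1 < b ->
  mu.-integrable `[-1, 1] (EFin \o jacobi_weight a b).
Proof.
move=> a1 b1.
pose C := 2 `^ `|a| + 2 `^ `|b| : R.
apply: (@le_integrable _ _ _ mu _ _ _
   (fun x => (C%:E * ((jacobi_weight a 0 x)%:E + (jacobi_weight 0 b x)%:E))%E)) => //.
- by apply/measurable_EFinP; apply: measurable_funTS; exact: measurable_jacobi_weight.
- move=> x; rewrite /= in_itv/= => x1.
  have pow_le (c y : R) : 1 <= y <= 2 -> y `^ c <= 2 `^ `|c|.
    move=> y12; apply: (@le_trans _ _ (y `^ `|c|)).
      by apply: ler_powR; [lra|exact: ler_norm].
    by apply: ge0_ler_powR; rewrite ?nnegrE//; lra.
  rewrite lee_fin ger0_norm ?mulr_ge0 ?powR_ge0//.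
  apply: le_trans (ler_norm _); rewrite /jacobi_weight !powRr0 mulr1 mul1r.
  have : 0 <= (1 - x) `^ a by exact: powR_ge0.
  have : 0 <= (1 + x) `^ b by exact: powR_ge0.
  have : 0 <= 2 `^ `|a| :> R by exact: powR_ge0.
  have : 0 <= 2 `^ `|b| :> R by exact: powR_ge0.
  have [x0|x0] := leP 0 x.
    have := pow_le b (1 + x); rewrite /C; nra.
  have := pow_le a (1 - x); rewrite /C; nra.
- apply: integrableZl => //; apply: integrableD => //.
    exact: integrable_jacobi_weightl.
  exact: integrable_jacobi_weightr.
Qed.

End JacobiWeight.

(** * Strict positivity of integrals, and polynomials times the weight *)

(** A zero integral would make [f] vanish almost everywhere on [D], but a ball around [x0] has
    positive measure. *)
Lemma Rintegral_gt0 (R : realType) (D : set R) (f : R -> R) (x0 : R) :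
  measurable D -> (@lebesgue_measure R).-integrable D (EFin \o f) ->
  (forall x, D x -> 0 <= f x) -> (\forall x \near x0, D x /\ 0 < f x) ->
  0 < \int[@lebesgue_measure R]_(x in D) f x.
Proof.
move=> mD fint f0 [e /= e0 De].
have mf := measurable_int _ fint.
rewrite lt_neqAle Rintegral_ge0// andbT eq_sym; apply/negP => /eqP If0.
have : (\int[@lebesgue_measure R]_(x in D) `|(EFin \o f) x| = 0)%E.
  rewrite (_ : 0%E = (\int[@lebesgue_measure R]_(x in D) f x)%:E); last by rewrite If0.
  rewrite /Rintegral fineK ?integrable_fin_num//.
  by apply: eq_integral => x /set_mem Dx; rewrite /= ger0_norm// f0.
move=> /(ae_eq_integral_abs (@lebesgue_measure R) mD mf) aeq.
have nb : (@lebesgue_measure R).-negligible (ball x0 e).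
  apply: negligibleS aeq => x /De[Dx fx] /= /(_ Dx) [].
  by move=> fx0; rewrite fx0 ltxx in fx.
have /eqP : @lebesgue_measure R (ball x0 e) = 0%E.
  by apply: measure_negligible nb; exact: measurable_ball.
rewrite lebesgue_measure_ball ?ltW//.
rewrite eqe; apply/negP; rewrite gt_eqF//; lra.
Qed.

(** The points 1 / (k + 2) with k < [size p] are distinct roots, too many for a nonzero
    polynomial. *)
Lemma poly_eq0_itv (R : numFieldType) (p : {poly R}) :
  (forall x, 0 < x < 1 -> p.[x] = 0) -> p = 0.
Proof.
move=> p0; apply: (@roots_geq_poly_eq0 _ p
    [seq k.+2%:R^-1 | k <- iota 0 (size p)]).
- apply/allP => _ /mapP[k _ ->]; rewrite rootE p0//.
  by rewrite invr_gt0 ltr0n invf_lt1 ?ltr0n// ltr1n.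
- rewrite map_inj_uniq ?iota_uniq// => i j /invr_inj /eqP.
  by rewrite eqr_nat => /eqP[].
- by rewrite size_map size_iota.
Qed.

(** This is (1 - x^2) d/dx conjugated by the weight w with exponents [a], [b]: (1 - x^2) (w p)' = w
    T p on (-1, 1), where T is this operator. *)
Definition weighted_deriv (R : nzRingType) (a b : R) (p : {poly R}) : {poly R} :=
  (1 - 'X ^+ 2) * p^`() + ((b - a)%:P - (a + b) *: 'X) * p.

Lemma is_derive_jacobi_weightM (R : realType) (a b x : R) (p : {poly R}) :
  -1 < x < 1 ->
  is_derive x 1 (fun y => jacobi_weight a b y * p.[y])
    (jacobi_weight (a - 1) (b - 1) x * (weighted_deriv a b p).[x]).
Proof.
move=> x1.
have dw := is_derive_jacobi_weight a b x1.
have dM := is_deriveM dw (is_derive_poly p x).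
apply: (@eq_ind _ _ (is_derive x 1 _) dM); rewrite /GRing.scale/=.
have -> : jacobi_weight a b x = jacobi_weight (a - 1) (b - 1) x * (1 - x ^+ 2).
  by rewrite -jacobi_weight11// -jacobi_weightD// !subrK.
rewrite /weighted_deriv !hornerE/= /jacobi_weight; ring.
Qed.

(** * The weighted inner product and Jacobi's equation *)

Section JacobiForm.
Variables (R : realType) (a b : R).
Hypotheses (a1 : -1 < a) (b1 : -1 < b).
Implicit Types p q g : {poly R}.
Local Notation mu := (@lebesgue_measure R).

(** [jacobi_int (p * q)] serves as the inner product of [p] and [q]. *)
Definition jacobi_int p : R :=
  \int[mu]_(x in `[-1, 1]) (jacobi_weight a b x * p.[x]).

Lemma integrable_jacobi_poly p :
  mu.-integrable `[-1, 1] (EFin \o (fun x => jacobi_weight a b x * p.[x])).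
Proof.
have bnd : [bounded p.[x] | x in `[-1, 1]%classic].
  (* Powers of x have modulus at most 1 on [-1, 1]. *)
  exists (\sum_(i < size p) `|p`_i|); split; first exact: num_real.
  move=> M pM x; rewrite /= in_itv/= => x1; apply: le_trans (ltW pM).
  rewrite horner_coef; apply: le_trans (ler_norm_sum _ _ _) _.
  apply: ler_sum => i _; rewrite normrM ler_piMr// normrX exprn_ile1//.
  by rewrite ler_norml.
apply: (@integrableMl _ _ _ mu `[-1, 1] _ (EFin \o jacobi_weight a b) (horner p)) => //.
- exact: integrable_jacobi_weight.
- apply: measurable_funTS; apply: continuous_measurable_fun.
  exact: continuous_horner.
Qed.

Lemma jacobi_intD p q : jacobi_int (p + q) = jacobi_int p + jacobi_int q.
Proof.
rewrite /jacobi_int -RintegralD//; try exact: integrable_jacobi_poly.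
by apply: eq_Rintegral => x _; rewrite hornerD mulrDr.
Qed.

Lemma jacobi_intZ (c : R) p : jacobi_int (c *: p) = c * jacobi_int p.
Proof.
rewrite /jacobi_int -RintegralZl//; try exact: integrable_jacobi_poly.
by apply: eq_Rintegral => x _; rewrite hornerZ mulrCA.
Qed.

Lemma jacobi_intB p q : jacobi_int (p - q) = jacobi_int p - jacobi_int q.
Proof. by rewrite -scaleN1r jacobi_intD jacobi_intZ mulN1r. Qed.

Lemma jacobi_int0 : jacobi_int 0 = 0.
Proof. by rewrite -(scale0r 0) jacobi_intZ mul0r. Qed.

(** If [p] is nonzero at some point of (0, 1), the integrand is positive near it by continuity. *)
Lemma jacobi_int_sqr_eq0 p : jacobi_int (p * p) = 0 -> p = 0.
Proof.
move=> Ip0; apply: poly_eq0_itv => x0 x01; apply/eqP; apply: contraT => px0.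
have /eqP := Ip0; rewrite /jacobi_int gt_eqF//.
apply: (@Rintegral_gt0 _ _ _ x0) => //.
- exact: integrable_jacobi_poly.
- move=> x _; rewrite hornerM mulr_ge0//; first by rewrite mulr_ge0 ?powR_ge0.
  by rewrite -expr2 sqr_ge0.
- near=> x.
  have x1 : -1 < x < 1.
    by apply/andP; split; near: x; [apply: lt_nbhsr|apply: lt_nbhsl]; lra.
  split; first by rewrite /= in_itv/=; lra.
  rewrite mulr_gt0 ?jacobi_weight_gt0// hornerM -expr2 exprn_even_gt0//=.
  near: x.
  have := @continuous_horner _ p x0 => /(_ [set y | y != 0]) /=; apply.
  by apply: open_nbhs_nbhs; split.
Unshelve. all: by end_near. Qed.

(** The integrand is the derivative of (1 - x)^(a + 1) (1 + x)^(b + 1) g, which vanishes at both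
    ends since the exponents are positive. *)
Lemma jacobi_int_deriv g : jacobi_int (weighted_deriv (a + 1) (b + 1) g) = 0.
Proof.
have a10 : 0 < a + 1 by move: a1; lra.
have b10 : 0 < b + 1 by move: b1; lra.
rewrite /jacobi_int.
pose F x := jacobi_weight (a + 1) (b + 1) x * g.[x].
have <- : F 1 - F (-1) = 0.
  rewrite /F /jacobi_weight !subrr powR0 ?gt_eqF// powR0 ?gt_eqF//.
  by rewrite mulr0 !mul0r subrr.
apply: improper_FTC2.
- lra.
- apply: within_continuousM.
    by apply: continuous_jacobi_weight; exact: ltW.
  by apply: continuous_subspaceT; exact: continuous_horner.
- move=> x; rewrite in_itv/= => x1.
  by have := is_derive_jacobi_weightM (a + 1) (b + 1) g x1; rewrite !addrK.
- move=> x; rewrite in_itv/= => x1.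
  apply: continuousM; last exact: continuous_horner.
  by apply: continuous_in_jacobi_weight; rewrite in_itv.
- exact: integrable_jacobi_poly.
Qed.

(* This is (1 - X^2) p'' + (b - a - (a + b + 2) X) p'. *)
Definition jacobi_op p : {poly R} := weighted_deriv (a + 1) (b + 1) p^`().

(** Lagrange's identity: the difference of the two integrands comes from the Wronskian p' q - p
    q'. *)
Lemma jacobi_op_sym p q :
  jacobi_int (jacobi_op p * q) = jacobi_int (p * jacobi_op q).
Proof.
apply/eqP; rewrite -subr_eq0 -jacobi_intB.
rewrite (_ : _ - _ = weighted_deriv (a + 1) (b + 1) (p^`() * q - p * q^`())) ?jacobi_int_deriv//.
rewrite /jacobi_op /weighted_deriv derivB !derivM; ring.
Qed.

Lemma coef_jacobi_op p i : (size p <= i.+1)%N ->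
  (jacobi_op p)`_i = - (i%:R * (i%:R + a + b + 1)) * p`_i.
Proof.
move=> sp.
have coefXd q : ('X * q^`())`_i = i%:R * q`_i.
  by rewrite coefXM coef_deriv; case: i {sp} => [|i]; rewrite ?mul0r// mulr_natl.
have p0 k : (i < k)%N -> p`_k = 0 by move=> ik; rewrite nth_default// (leq_trans sp).
(* The Euler operator x d/dx multiplies the coefficient of x^i by i, and x^2 p'' = x (x p')' - x p'.
   The bare p' and p'' contribute nothing at x^i, by the size bound. *)
have -> : jacobi_op p = p^`(2) - 'X * ('X * p^`())^`() + 'X * p^`()
    + (b - a) *: p^`() - (a + b + 2) *: ('X * p^`()).
  rewrite /jacobi_op /weighted_deriv derivM derivX -!mul_polyC derivnS derivn1; ring.
rewrite !(coefD, coefN, coefZ) !coefXd !coef_deriv !(p0 i.+1) ?(p0 i.+2)// !mul0rn.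
ring.
Qed.

Variable P : nat -> {poly R}.
Hypothesis hP : jacobi_polynomials a b P.

(** Induction on a bound for the size of [q]: subtracting the multiple of [P m] that cancels the
    coefficient of x^m lowers the size and leaves the integral unchanged. *)
Lemma jacobi_orth n q : (size q <= n)%N -> jacobi_int (P n * q) = 0.
Proof.
have [sP oP _] := hP.
move: {2}(size q) (leqnn (size q)) => m; elim: m q => [|m IH] q.
  by rewrite leqn0 size_poly_eq0 => /eqP-> _; rewrite mulr0 jacobi_int0.
move=> qm qn; have [sq|mq] := leqP (size q) m; first exact: IH.
have mn : (m < n)%N by exact: leq_trans mq qn.
have Pm0 : (P m)`_m != 0.
  by have := lead_coef_eq0 (P m); rewrite lead_coefE sP /= => ->; rewrite -size_poly_eq0 sP.
pose c := q`_m / (P m)`_m.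
have -> : q = (q - c *: P m) + c *: P m by rewrite subrK.
rewrite mulrDr -scalerAr jacobi_intD jacobi_intZ.
have -> : jacobi_int (P n * P m) = 0.
  rewrite /jacobi_int /Rintegral.
  under eq_integral do rewrite hornerM mulrA /jacobi_weight.
  by rewrite oP// => nm; rewrite nm ltnn in mn.
rewrite mulr0 addr0; apply: IH.
  apply/leq_sizeP => j; rewrite leq_eqVlt => /predU1P[<-|mj].
    by rewrite coefB coefZ /c divfK// subrr.
  by rewrite coefB coefZ !nth_default ?mulr0 ?subrr// ?sP// (leq_trans qm).
apply/leq_sizeP => j nj.
have mj : (m < j)%N by exact: leq_trans mn nj.
by rewrite coefB coefZ !nth_default ?mulr0 ?subrr// ?sP// (leq_trans qm).
Qed.

Lemma jacobi_ode n : jacobi_op (P n) = - (n%:R * (n%:R + a + b + 1)) *: P n.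
Proof.
have [sP _ _] := hP.
pose lam := n%:R * (n%:R + a + b + 1).
have size_r q : (size q <= n)%N -> (size (jacobi_op q + lam *: q)%R <= n)%N.
  move=> qn; apply/leq_sizeP => j nj.
  rewrite coefD coefZ coef_jacobi_op; last by rewrite (leq_trans qn)// leqW.
  by rewrite nth_default ?mulr0 ?addr0// (leq_trans qn).
pose r := jacobi_op (P n) + lam *: P n.
have rn : (size r <= n)%N.
  apply/leq_sizeP => j nj.
  rewrite coefD coefZ coef_jacobi_op ?sP// -mulrDl.
  (* At j = n the eigenvalue cancels; beyond n the coefficients of [P n] are zero. *)
  move: nj; rewrite leq_eqVlt => /predU1P[<-|nj]; first by rewrite addrC subrr mul0r.
  by rewrite nth_default ?mulr0// sP.
suff r0 : r = 0 by apply/eqP; rewrite scaleNr -addr_eq0 -/lam -/r r0.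
apply: jacobi_int_sqr_eq0.
rewrite {1}/r mulrDl jacobi_intD jacobi_op_sym -scalerAl scalerAr -jacobi_intD -mulrDr.
by apply: jacobi_orth; exact: size_r.
Qed.

End JacobiForm.

(** * Positivity of Gamma and of the normalizing constant *)

Lemma integrable_powR01 (R : realType) (s : R) : -1 < s ->
  (@lebesgue_measure R).-integrable `[0, 1] (EFin \o (fun t => t `^ s)).
Proof.
move=> s1; have s10 : 0 < s + 1 by lra.
apply: (@ge0_derivative_integrable R (fun t => (s + 1)^-1 * t `^ (s + 1))).
- lra.
- apply: within_continuousM; first exact: cst_continuous.
  apply: (@subspace_eq_continuous _ _ _ (fun t : R => Num.max t 0 `^ (s + 1))).
    move=> t /set_mem; rewrite /= in_itv/= => t1.
    by rewrite /from_subspace max_l//; lra.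
  by apply: continuous_subspaceT; apply: continuous_powR_max0; exact: ltW.
- move=> t; rewrite in_itv/= => /andP[t0 _].
  have dt := is_deriveZ (s + 1)^-1 (@is_derive1_powR R (s + 1) t t0).
  apply: (@eq_ind _ _ (is_derive t 1 _) dt).
  by rewrite /GRing.scale/= addrK mulrA mulVf ?mul1r// gt_eqF.
- move=> t; rewrite in_itv/= => /andP[t0 _].
  apply: differentiable_continuous; apply/derivable1_diffP.
  by apply: derivable_powR; rewrite in_itv/= t0.
- by move=> t _; exact: powR_ge0.
Qed.

(** For t >= 1 the power is at most t^(n + 1) for a natural n, and a single term of the series of
    exp(t / 2) bounds that. The half leaves a factor exp(-t / 2) for convergence of the Gamma
    integral. *)
Lemma powR_le_expR (R : realType) (s : R) :
  exists2 C : R, 0 <= C & forall t, 1 <= t -> t `^ s <= C * expR (t / 2).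
Proof.
have [n sn] : exists n : nat, s <= n.+1%:R.
  exists (Num.bound `|s|); apply: le_trans (ler_norm s) _.
  by apply: le_trans (ltW (archi_boundP (normr_ge0 s))) _; rewrite ler_nat.
exists (2 ^+ n.+1 * n.+1`!%:R) => [|t t1]; first by rewrite mulr_ge0 ?exprn_ge0 ?ler0n.
apply: le_trans (ler_powR t1 sn) _; rewrite powR_mulrn; last lra.
have t20 : 0 <= t / 2 by lra.
have := expR_ge1Dxn n t20; rewrite expr_div_n => le_exp.
have : t ^+ n.+1 / 2 ^+ n.+1 / n.+1`!%:R <= expR (t / 2) by lra.
by rewrite -mulrA -invfM ler_pdivrMr ?mulr_gt0 ?exprn_gt0 ?ltr0n ?fact_gt0// mulrC.
Qed.

(** The work is integrability: t^(s - 1) dominates on (0, 1] and C exp(-t / 2) beyond 1. Positivity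
    is then read off near t = 1. *)
Lemma gamma_integral_gt0 (R : realType) (s : R) : 0 < s -> 0 < gamma_integral s.
Proof.
move=> s0; rewrite /gamma_integral.
apply: (@Rintegral_gt0 _ _ _ 1) => //.
- have [C C0 leC] := powR_le_expR (s - 1).
  have mf : measurable_fun [set: R] (fun t : R => t `^ (s - 1) * expR (- t)).
    apply: measurable_funM; first exact: measurable_powR.
    by apply: measurableT_comp => //; exact: measurable_funN.
  have int1 : (@lebesgue_measure R).-integrable [set: R]
      (EFin \o ((fun t => t `^ (s - 1)) \_ `[0, 1])).
    rewrite -restrict_EFin; apply/integrable_restrict => //; rewrite setTI.
    by apply: integrable_powR01; lra.
  have int2 : (@lebesgue_measure R).-integrable [set: R]
      (* The exponential density of rate 1/2 is exp(-t / 2) / 2, hence the factor 2. *)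
      (fun t => ((2 * C)%:E * (exponential_pdf 2^-1 t)%:E)%E).
    apply: integrableZl => //; apply: integrable_exponential_pdf => //; lra.
  have int12 := integrableD measurableT int1 int2.
  have {}int12 := @integrableS _ _ _ (@lebesgue_measure R) _ `]0, +oo[ _
    measurableT (measurable_itv _) (@subsetT _ _) int12.
  apply: le_integrable int12 => //; first by apply/measurable_EFinP; apply: measurable_funTS.
  move=> t; rewrite /= in_itv/= andbT => t0.
  rewrite lee_fin ger0_norm ?mulr_ge0 ?powR_ge0 ?expR_ge0//.
  apply: le_trans (ler_norm _); rewrite exponential_pdfE; last exact: ltW.
  rewrite patchE.
  have [t1|t1] := leP t 1.
    rewrite mem_set; last by rewrite /= in_itv/= t1 ltW.
    rewrite (le_trans (_ : _ <= t `^ (s - 1)))//.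
      by rewrite ler_piMr ?powR_ge0// -expR0 ler_expR; lra.
    by rewrite lerDl !mulr_ge0 ?expR_ge0.
  rewrite memNset; last by rewrite /= in_itv/= => /andP[_]; rewrite leNgt t1.
  rewrite add0r (_ : - t = - (t / 2) - t / 2); last lra.
  rewrite expRD mulrA (_ : - 2^-1 * t = - (t / 2)); last lra.
  rewrite (_ : 2 * C * (2^-1 * expR (- (t / 2))) = C * expR (- (t / 2))); last lra.
  rewrite ler_pM2r ?expR_gt0// expRN ler_pdivrMr ?expR_gt0//.
  by apply: leC; exact: ltW.
- by move=> t _; rewrite mulr_ge0 ?powR_ge0 ?expR_ge0.
- near=> t; have t0 : 0 < t by near: t; apply: lt_nbhsr; lra.
  by rewrite /= in_itv/= t0 mulr_gt0 ?powR_gt0 ?expR_gt0.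
Unshelve. all: by end_near. Qed.

Lemma gamma_gt0 (R : realType) (s : R) : 0 < s -> 0 < gamma s.
Proof. by move=> s0; rewrite /gamma s0 addr0 big_ord0 divr1 gamma_integral_gt0. Qed.

(* For n = 0 the argument s = a + b + 1 of Gamma may be negative. *)
Lemma mulr_gamma_gt0 (R : realType) (s : R) : -1 < s -> s != 0 -> 0 < s * gamma s.
Proof.
move=> s1 s0; have [sp|sn] := ltP 0 s; first by rewrite mulr_gt0 ?gamma_gt0.
have sneg : s < 0 by rewrite lt_neqAle s0.
(* For -1 < s < 0 the definition takes exactly one step of the functional equation, as -s truncates
   to 0. *)
have -> : gamma s = gamma_integral (s + 1) / s.
  rewrite /gamma ltNge sn /=.
  have -> : Num.truncn (- s) = 0%N.
    apply: truncn_def; apply/andP; split; lra.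
  by rewrite big_ord_recl big_ord0 mulr1 addr0.
by rewrite mulrC divfK// gamma_integral_gt0//; lra.
Qed.

Lemma jacobi_norm_const_gt0 (R : realType) (a b : R) (n : nat) :
  -1 < a -> -1 < b -> 0 < jacobi_norm_const a b n.
Proof.
move=> a1 b1; rewrite /jacobi_norm_const.
set c := (if _ then _ else _).
have n0 : 0 <= n%:R :> R by exact: ler0n.
have c0 : 0 < c.
  (* For n = 0 this is either the convention at a + b = -1 or s Gamma(s) with s = a + b + 1 > -1;
     for n >= 1 both factors are positive since a + b > -2. *)
  rewrite /c; case: n n0 @c => [|n] n0 /=.
    case: eqP => [_|/eqP ab]; first by apply: gamma_gt0; lra.
    rewrite mulr0 !add0r; apply: mulr_gamma_gt0; first lra.
    by apply: contra ab => /eqP ab; apply/eqP; lra.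
  have n1 : 1 <= n.+1%:R :> R by rewrite ler1n.
  by rewrite mulr_gt0 ?gamma_gt0//; lra.
have ga : 0 < gamma (n%:R + a + 1) by apply: gamma_gt0; lra.
have gb : 0 < gamma (n%:R + b + 1) by apply: gamma_gt0; lra.
have nf : 0 < n`!%:R :> R by rewrite ltr0n fact_gt0.
rewrite sqrtr_gt0; apply: divr_gt0; first exact: mulr_gt0.
by apply: mulr_gt0 gb; apply: mulr_gt0 ga; apply: powR_gt0; lra.
Qed.

(** * The equation for the weighted polynomial *)

(** With g = (b - a - (a + b) x) / 2 and T = (1 - x^2) d/dx + g, one has T^2 = (1 - x^2) L + g^2 +
    (1 - x^2) g', L being Jacobi's operator. The last two terms are exactly the potential. *)
Lemma schroedinger_of_jacobi_ode (R : realType) (a b : R) (p : {poly R}) (lam : R)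
    (x : R) : jacobi_op a b p = - lam *: p ->
  - (weighted_deriv (a / 2) (b / 2) (weighted_deriv (a / 2) (b / 2) p)).[x]
  + ((a / 2) ^+ 2 * (1 + x) ^+ 2 + (b / 2) ^+ 2 * (1 - x) ^+ 2
     - (a * b + a + b) / 2 * (1 - x ^+ 2)) * p.[x]
  = lam * (1 - x ^+ 2) * p.[x].
Proof.
move=> /(congr1 (fun q => (1 - x ^+ 2) * q.[x])).
rewrite /jacobi_op /weighted_deriv !(derivD, derivM, derivB, derivN,
  derivZ, derivC, derivX, derivXn).
rewrite !hornerE/= => H.
lra.
Qed.

Theorem theorem5p6 (R : realType) (a b : R) (ha : -1 < a) (hb : -1 < b)
    (P : nat -> {poly R}) (hP : jacobi_polynomials a b P) (n : nat) :
  let u : R -> R := jacobi_weighted a b P n in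
  let Du : R -> R := fun y => (1 - y ^+ 2) * derive1 u y in
  (exists x : R, -1 < x < 1 /\ u x <> 0) /\
  (forall x : R, -1 < x < 1 ->
    [/\ derivable u x 1,
        derivable Du x 1 &
        - (1 - x ^+ 2) * derive1 Du x
        + ((a / 2) ^+ 2 * (1 + x) ^+ 2 + (b / 2) ^+ 2 * (1 - x) ^+ 2
           - (a * b + a + b) / 2 * (1 - x ^+ 2)) * u x
        = n%:R * (n%:R + a + b + 1) * (1 - x ^+ 2) * u x]).
Proof.
move=> u Du.
set c := jacobi_norm_const a b n.
have c0 : 0 < c by exact: jacobi_norm_const_gt0.
have uE y : u y = jacobi_weight (a / 2) (b / 2) y * (c *: P n).[y].
  by rewrite hornerZ.
pose T := weighted_deriv (a / 2) (b / 2).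
(* The factor 1 - y^2 restores the exponents lowered by differentiation. *)
have weightS (y : R) : -1 < y < 1 -> (1 - y ^+ 2) * jacobi_weight (a / 2 - 1) (b / 2 - 1) y =
    jacobi_weight (a / 2) (b / 2) y.
  by move=> y1; rewrite mulrC -jacobi_weight11// -jacobi_weightD// !subrK.
have du (y : R) : -1 < y < 1 -> is_derive y 1 u
    (jacobi_weight (a / 2 - 1) (b / 2 - 1) y * (T (c *: P n)).[y]).
  move=> y1; rewrite (_ : u = fun y => jacobi_weight (a / 2) (b / 2) y * (c *: P n).[y]).
    exact: is_derive_jacobi_weightM.
  by apply/funext => z; rewrite uE.
have DuE (y : R) : -1 < y < 1 -> Du y = jacobi_weight (a / 2) (b / 2) y * (T (c *: P n)).[y].
  move=> y1; rewrite /Du derive1E (@derive_val _ _ _ _ _ _ _ (du y y1)).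
  by rewrite mulrA weightS.
have dDu (y : R) : -1 < y < 1 -> is_derive y 1 Du
    (jacobi_weight (a / 2 - 1) (b / 2 - 1) y * (T (T (c *: P n))).[y]).
  (* [DuE] holds only inside (-1, 1), which is enough near [y]. *)
  move=> y1; apply: near_eq_is_derive; last exact: is_derive_jacobi_weightM.
  near=> z; rewrite DuE//.
  by apply/andP; split; near: z; [apply: lt_nbhsr|apply: lt_nbhsl]; lra.
split.
  (* If [u] vanished throughout (-1, 1), so would [P n] on (0, 1), against its size n + 1. *)
  apply: contrapT => nu.
  have P0 : P n = 0.
    apply: poly_eq0_itv => x x01; have x1 : -1 < x < 1 by lra.
    apply: contrapT => px; apply: nu; exists x; split => //; rewrite uE hornerZ.
    have w0 := jacobi_weight_gt0 (a / 2) (b / 2) x1.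
    by apply/eqP; apply: mulf_neq0 (lt0r_neq0 w0) _; apply: mulf_neq0 (lt0r_neq0 c0) _; exact/eqP.
  by have [sP _ _] := hP; have := sP n; rewrite P0 size_poly0.
move=> x x1; have du' := du x x1; have dDu' := dDu x x1; split => //.
rewrite derive1E (@derive_val _ _ _ _ _ _ _ dDu') uE.
(* Every term carries the same weight factor; taking it out leaves a polynomial identity. *)
rewrite mulNr [X in - X]mulrA weightS// -mulrN [X in _ + X]mulrCA.
rewrite [RHS]mulrCA -mulrDr; congr (_ * _).
apply: schroedinger_of_jacobi_ode.
have -> : jacobi_op a b (c *: P n) = c *: jacobi_op a b (P n).
  by rewrite /jacobi_op /weighted_deriv !derivZ scalerDr -!scalerAr.
by rewrite jacobi_ode// scalerA mulrC -scalerA.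
Unshelve. all: by end_near. Qed.
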